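(* Let $D\ge 1$ and let $\mathcal{A}^D_{\hbar,q}(\mathcal{F})$ be a shift algebra such that $\mathcal{F}$ separates points of $\mathbb{R}^D$. Let $R,\tilde R\in\mathrm{Mat}_D(\mathbb{Z})$ have nonzero determinant and let $\delta,\tilde\delta\in\mathbb{R}^D$. Then $\mathcal{S}_\hbar(R,\delta)\simeq\mathcal{S}_\hbar(\tilde R,\tilde\delta)$ as left $\mathcal{A}^D_{\hbar,q}(\mathcal{F})$-modules if and only if $R\tilde R^{-1}\in\mathrm{GL}_D(\mathbb{Z})$ and $R(\delta-\tilde\delta)\in\mathbb{Z}^D$.
   Context: $F(\mathbb{R}^D,\mathbb{C})$ is the $\ast$-algebra of all complex valued functions on $\mathbb{R}^D$ (involution = complex conjugation). For $\hbar>0$, $k\in\mathbb{Z}^D$ put $(S_\hbar^k f)(u)=f(u+k\hbar)$. A $\ast$-subalgebra $\mathcal{F}\subseteq F(\mathbb{R}^D,\mathbb{C})$ is $\hbar$-invariant if $S_\hbar^kf\in\mathcal{F}$ for all $f\in\mathcal{F}$, $k\in\mathbb{Z}^D$; it separates points if for any distinct $x,y\in\mathbb{R}^D$ there is $f\in\mathcal{F}$ with $f(x)\ne f(y)$. For $k,l\in\mathbb{R}^D$ let $N(k,l)=\sum_{m=2}^D\sum_{n=1}^{m-1}k_ml_n$ (and $N=0$ if $D=1$). For $q\in\mathbb{C}$, $|q|=1$, a real $\theta$ with $q=e^{i\theta}$ is fixed and $q^t=e^{i\theta t}$ for $t\in\mathbb{R}$. Shift algebra: for $\hbar>0$, $|q|=1$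 and $\mathcal{F}$ an $\hbar$-invariant $\ast$-subalgebra of $F(\mathbb{R}^D,\mathbb{C})$, $\mathcal{A}^D_{\hbar,q}(\mathcal{F})$ consists of finite formal sums $\sum_{k\in\mathbb{Z}^D}f_kU^k$, $f_k\in\mathcal{F}$, with product $(\sum_kf_kU^k)(\sum_lg_lU^l)=\sum_{k,l}q^{N(k,l)}f_k(S_\hbar^kg_l)U^{k+l}$. Modules: for $R\in\mathrm{Mat}_D(\mathbb{Z})$ with $\det R\neq0$ and $\delta\in\mathbb{R}^D$, $\mathcal{S}_\hbar(R,\delta)$ is the space of finitely supported functions $\xi:\mathbb{Z}^D\to\mathbb{C}$ with the left action $(f\xi)(k)=\sum_{n\in\mathbb{Z}^D}q^{N(R^{-1}k+\delta,n)}f_n\big((R^{-1}k+\delta)\hbar\big)\xi(k+Rn)$ for $f=\sum_nf_nU^n$. *)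

(* Defs.v *)
From HB Require Import structures.
From mathcomp Require Import all_boot all_order all_algebra.
From mathcomp Require Import finmap.
From mathcomp Require Import boolp classical_sets functions reals trigo.
From mathcomp Require Import complex.
From mathcomp Require Import ring.

Set Implicit Arguments.
Unset Strict Implicit.
Unset Printing Implicit Defensive.

Import Order.TTheory GRing.Theory Num.Theory.

Local Open Scope fset_scope.
Local Open Scope ring_scope.

(** * Finitely supported functions as a module *)

Definition fsupp (I : choiceType) (K : pzRingType) (V : lmodType K) : Type :=
  {fsfun I -> V with 0}.

Section Fsupp.
Variables (I : choiceType) (K : pzRingType) (V : lmodType K).
Implicit Types a b : fsupp I V.

HB.instance Definition _ := Choice.on (fsupp I V).

Definition fsupp_zero : fsupp I V := [fsfun with 0].
Definition fsupp_add a b : fsupp I V :=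
  [fsfun i in finsupp a `|` finsupp b => a i + b i | 0].
Definition fsupp_opp a : fsupp I V := [fsfun i in finsupp a => - a i | 0].
Definition fsupp_scale (c : K) a : fsupp I V :=
  [fsfun i in finsupp a => c *: a i | 0].

Lemma fsuppP a b : (forall i, a i = b i) <-> a = b.
Proof. by split=> [ab|->//]; apply/(@fsfunP I V (fun=> 0) a b). Qed.

Lemma fsupp_out a i : i \notin finsupp a -> a i = 0.
Proof. exact: (@fsfun_dflt I V (fun=> 0)). Qed.

Lemma fsupp_inE a i : (i \in finsupp a) = (a i != 0).
Proof. exact: mem_finsupp. Qed.

Lemma fsupp_zeroE i : fsupp_zero i = 0.
Proof. exact: fsfun0E. Qed.

Lemma fsupp_addE a b i : fsupp_add a b i = a i + b i.
Proof.
rewrite /fsupp_add fsfunE inE.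
have [//|/=] := boolP (i \in finsupp a).
move/fsupp_out=> ->; have [//|/=] := boolP (i \in finsupp b).
by move/fsupp_out=> ->; rewrite addr0.
Qed.

Lemma fsupp_oppE a i : fsupp_opp a i = - a i.
Proof.
rewrite /fsupp_opp fsfunE.
by case: ifPn => // /fsupp_out ->; rewrite oppr0.
Qed.

Lemma fsupp_scaleE c a i : fsupp_scale c a i = c *: a i.
Proof.
rewrite /fsupp_scale fsfunE.
by case: ifPn => // /fsupp_out ->; rewrite scaler0.
Qed.

Fact fsupp_addA : associative fsupp_add.
Proof. by move=> a b c; apply/fsuppP=> i; rewrite !fsupp_addE addrA. Qed.
Fact fsupp_addC : commutative fsupp_add.
Proof. by move=> a b; apply/fsuppP=> i; rewrite !fsupp_addE addrC. Qed.
Fact fsupp_add0 : left_id fsupp_zero fsupp_add.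
Proof. by move=> a; apply/fsuppP=> i; rewrite fsupp_addE fsupp_zeroE add0r. Qed.
Fact fsupp_addN : left_inverse fsupp_zero fsupp_opp fsupp_add.
Proof.
by move=> a; apply/fsuppP=> i; rewrite fsupp_addE fsupp_oppE fsupp_zeroE addNr.
Qed.
HB.instance Definition _ := GRing.isZmodule.Build (fsupp I V)
  fsupp_addA fsupp_addC fsupp_add0 fsupp_addN.

Lemma fsupp0 i : (0 : fsupp I V) i = 0.
Proof. exact: fsupp_zeroE. Qed.
Lemma fsuppD a b i : (a + b) i = a i + b i.
Proof. exact: fsupp_addE. Qed.

Fact fsupp_scaleA c d a : fsupp_scale c (fsupp_scale d a) = fsupp_scale (c * d) a.
Proof. by apply/fsuppP=> i; rewrite !fsupp_scaleE scalerA. Qed.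
Fact fsupp_scale1 : left_id 1 fsupp_scale.
Proof. by move=> a; apply/fsuppP=> i; rewrite fsupp_scaleE scale1r. Qed.
Fact fsupp_scaleDr : right_distributive fsupp_scale +%R.
Proof.
by move=> c a b; apply/fsuppP=> i; rewrite !(fsuppD, fsupp_scaleE) scalerDr.
Qed.
Fact fsupp_scaleDl a : {morph fsupp_scale^~ a : c d / c + d}.
Proof.
by move=> c d; apply/fsuppP=> i; rewrite !(fsuppD, fsupp_scaleE) scalerDl.
Qed.
HB.instance Definition _ := GRing.Zmodule_isLmodule.Build K (fsupp I V)
  fsupp_scaleA fsupp_scale1 fsupp_scaleDr fsupp_scaleDl.

Lemma fsuppZ c a i : (c *: a) i = c *: a i.
Proof. exact: fsupp_scaleE. Qed.
Lemma fsupp_sum (J : Type) (r : seq J) (F : J -> fsupp I V) i :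
  (\sum_(j <- r) F j) i = \sum_(j <- r) F j i.
Proof.
by elim: r => [|j r IH]; rewrite ?big_nil ?fsupp0 // !big_cons fsuppD IH.
Qed.

(* The formal monomial [v U^i]. *)
Definition fmono (i : I) (v : V) : fsupp I V := [fsfun j in [fset i] => v | 0].

Lemma fmonoE i v j : fmono i v j = if j == i then v else 0.
Proof. by rewrite /fmono fsfunE inE. Qed.

Lemma fmono_linear i : linear (fmono i).
Proof.
move=> c u v; apply/fsuppP=> j; rewrite fsuppD fsuppZ !fmonoE.
by case: eqP; rewrite // scaler0 addr0.
Qed.

Lemma fmono0 i : fmono i 0 = 0.
Proof. by apply/fsuppP=> j; rewrite fmonoE fsupp0; case: eqP. Qed.

Lemma fsupp_expand a : a = \sum_(i <- finsupp a) fmono i (a i).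
Proof.
apply/fsuppP=> j; rewrite fsupp_sum.
have [ja|ja] := boolP (j \in finsupp a).
  rewrite (big_fsetD1 _ ja) /= fmonoE eqxx big_seq big1 ?addr0 // => i.
  by rewrite !inE => /andP[ij _]; rewrite fmonoE eq_sym (negPf ij).
rewrite (fsupp_out ja) big_seq big1 // => i ia; rewrite fmonoE.
by case: eqP => // ji; rewrite ji ia in ja.
Qed.

Section Sums.
Variables (W : lmodType K) (G : I -> V -> W).
Hypothesis Glin : forall i, linear (G i).

Let lin0 (U1 U2 : lmodType K) (f : U1 -> U2) : linear f -> f 0 = 0.
Proof.
move=> /(_ 1 0 0); rewrite !scale1r addr0 => h.
by apply: (addrI (f 0)); rewrite -h addr0.
Qed.

Lemma fsupp_sum_incl a (B : {fset I}) : finsupp a `<=` B ->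
  \sum_(i <- finsupp a) G i (a i) = \sum_(i <- B) G i (a i).
Proof.
move=> aB; apply: big_fset_incl => // i _ /fsupp_out ->.
exact: lin0 (Glin i).
Qed.

Lemma fsupp_sum_linear :
  linear (fun a : fsupp I V => \sum_(i <- finsupp a) G i (a i)).
Proof.
move=> c a b; set B := finsupp a `|` finsupp b.
rewrite (@fsupp_sum_incl (c *: a + b) B); last first.
  apply/fsubsetP=> i; rewrite in_fsetU; apply: contraLR; rewrite negb_or.
  move=> /andP[/fsupp_out ia /fsupp_out ib].
  by rewrite fsupp_inE fsuppD fsuppZ ia ib scaler0 addr0 eqxx.
rewrite (@fsupp_sum_incl a B) ?fsubsetUl // (@fsupp_sum_incl b B) ?fsubsetUr //.
rewrite scaler_sumr -big_split; apply: eq_bigr => i _ /=.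
by rewrite fsuppD fsuppZ Glin.
Qed.

Lemma fsupp_sum_mono i v :
  \sum_(j <- finsupp (fmono i v)) G j (fmono i v j) = G i v.
Proof.
rewrite (@fsupp_sum_incl _ [fset i]).
  by rewrite big_seq_fset1 fmonoE eqxx.
apply/fsubsetP=> j; rewrite fsupp_inE fmonoE inE.
by case: (j == i); rewrite ?eqxx.
Qed.

Lemma linear_fsupp_ext (f g : fsupp I V -> W) : linear f -> linear g ->
  (forall i v, f (fmono i v) = g (fmono i v)) -> forall a, f a = g a.
Proof.
move=> fl gl fg a; rewrite (fsupp_expand a).
elim: (enum_fset (finsupp a)) => [|i r IH].
  by rewrite big_nil (lin0 fl) (lin0 gl).
rewrite big_cons -[fmono i _]scale1r fl gl IH; congr (_ *: _ + _).
exact: fg.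
Qed.
End Sums.

End Fsupp.

(** * Associative algebras, not assumed unital, and their left modules *)

Record assocAlg (K : pzRingType) := AssocAlg {
  assocAlg_sort :> lmodType K;
  alg_mul : assocAlg_sort -> assocAlg_sort -> assocAlg_sort;
  alg_mul_linl : forall b, linear (fun a => alg_mul a b);
  alg_mul_linr : forall a, linear (alg_mul a);
  alg_mulA : associative alg_mul }.

Record leftModule (K : pzRingType) (A : assocAlg K) := LeftModule {
  leftModule_sort :> lmodType K;
  mod_act : A -> leftModule_sort -> leftModule_sort;
  mod_act_linl : forall x, linear (fun a => mod_act a x);
  mod_act_linr : forall a, linear (mod_act a);
  mod_actM : forall a b x, mod_act (alg_mul a b) x = mod_act a (mod_act b x) }.

Definition isomorphic_modules (K : pzRingType) (A : assocAlg K)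
    (V W : leftModule A) : Prop :=
  exists phi : {linear V -> W},
    bijective phi /\ forall (a : A) (x : V), phi (mod_act a x) = mod_act a (phi x).

(** * The coefficient algebras *)

(* [R[i]^o] is [R[i]] seen as a module over itself: [R[i]] alone is registered
   as a module over [R]. *)
Notation cfun R D := ('cV[R]_D -> R[i]^o).

Definition intv (R : pzRingType) (D : nat) (k : 'cV[int]_D) : 'cV[R]_D :=
  map_mx intr k.

Definition shiftf (R : realType) (D : nat) (hbar : R) (k : 'cV[int]_D)
    (f : cfun R D) : cfun R D :=
  fun u => f (u + hbar *: intv R k).

Definition star_subalgebra (R : realType) (D : nat) (F : set (cfun R D)) : Prop :=
  [/\ F (fun=> 0),
      forall (c : R[i]) f g, F f -> F g -> F (fun u => c * f u + g u),
      forall f g, F f -> F g -> F (fun u => f u * g u)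
    & forall f, F f -> F (fun u => (f u)^*)].

Definition hbar_invariant (R : realType) (D : nat) (hbar : R)
    (F : set (cfun R D)) : Prop :=
  forall f k, F f -> F (shiftf hbar k f).

Definition separates_points (R : realType) (D : nat) (F : set (cfun R D)) : Prop :=
  forall x y : 'cV[R]_D, x <> y -> exists2 f, F f & f x <> f y.

Record invSubalg (R : realType) (D : nat) (hbar : R) := InvSubalg {
  inv_set :> set (cfun R D);
  inv_star : star_subalgebra inv_set;
  inv_hbar : hbar_invariant hbar inv_set }.

Section Coefficients.
Variables (R : realType) (D : nat) (hbar : R) (F : invSubalg D hbar).

Definition coef_pred : {pred cfun R D} := fun f => `[< inv_set F f >].

Record coef := Coef { coef_fun :> cfun R D; coef_funP : coef_fun \in coef_pred }.

Fact coef_pred_submod : submod_closed coef_pred.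
Proof.
have [F0 FD _ _] := inv_star F.
split=> [|c f g /asboolP Ff /asboolP Fg]; apply/asboolP; first exact: F0.
exact: FD.
Qed.
HB.instance Definition _ :=
  GRing.isSubmodClosed.Build R[i] (cfun R D) coef_pred coef_pred_submod.
HB.instance Definition _ := [isSub for coef_fun].
HB.instance Definition _ := [Choice of coef by <:].
HB.instance Definition _ := [SubChoice_isSubLmodule of coef by <:].

Fact coef_mul_subproof (f g : coef) : (fun u => f u * g u) \in coef_pred.
Proof.
have [_ _ FM _] := inv_star F.
by apply/asboolP; apply: FM; apply/asboolP; apply: coef_funP.
Qed.
Definition coef_mul (f g : coef) : coef := Coef (coef_mul_subproof f g).

Fact coef_shift_subproof k (f : coef) : shiftf hbar k f \in coef_pred.
Proof. by apply/asboolP/inv_hbar/asboolP/coef_funP. Qed.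
Definition coef_shift k (f : coef) : coef := Coef (coef_shift_subproof k f).

Lemma coefP (f g : coef) : (forall u, f u = g u) -> f = g.
Proof. by move=> fg; apply/val_inj/funext. Qed.
Lemma coefD (f g : coef) u : (f + g) u = f u + g u. Proof. by []. Qed.
Lemma coefZ c (f : coef) u : (c *: f) u = c * f u. Proof. by []. Qed.
Lemma coef_mulE (f g : coef) u : coef_mul f g u = f u * g u. Proof. by []. Qed.
Lemma coef_shiftE k (f : coef) u :
  coef_shift k f u = f (u + hbar *: intv R k).
Proof. by []. Qed.
End Coefficients.

(** * Shift algebras *)

Definition Nform (R : pzRingType) (D : nat) (k l : 'cV[R]_D) : R :=
  \sum_(m < D) \sum_(n < D | (n < m)%N) k m 0 * l n 0.

(* [qpow theta t] is [q^t], for the fixed argument [theta] of [q]. *)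
Definition qpow (R : realType) (theta t : R) : R[i] :=
  (cos (theta * t) +i* sin (theta * t))%C.

Section Phases.
Variables (R : realType) (D : nat).
Implicit Types k l m : 'cV[R]_D.

Lemma NformDl k l m : Nform (k + l) m = Nform k m + Nform l m.
Proof.
rewrite /Nform -big_split; apply: eq_bigr => i _; rewrite -big_split.
by apply: eq_bigr => j _; rewrite mxE mulrDl.
Qed.

Lemma NformDr k l m : Nform k (l + m) = Nform k l + Nform k m.
Proof.
rewrite /Nform -big_split; apply: eq_bigr => i _; rewrite -big_split.
by apply: eq_bigr => j _; rewrite mxE mulrDr.
Qed.

Lemma qpowD (theta s t : R) : qpow theta (s + t) = qpow theta s * qpow theta t.
Proof. by rewrite /qpow mulrDr cosD sinD; simpc; rewrite (addrC (sin _ * _)). Qed.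

Lemma intvD (k l : 'cV[int]_D) : intv R (k + l) = intv R k + intv R l.
Proof. exact: map_mxD. Qed.
End Phases.

Section ShiftAlgebra.
Variables (R : realType) (D : nat) (hbar theta : R) (F : invSubalg D hbar).

(* The formal sum of the [f_k U^k] is the function [k |-> f_k]. *)
Local Notation A := (fsupp 'cV[int]_D (coef F)).
Implicit Types a b c : A.

Definition shift_coef (k l : 'cV[int]_D) (f g : coef F) : coef F :=
  qpow theta (Nform (intv R k) (intv R l)) *: coef_mul f (coef_shift k g).

Definition shift_mul a b : A :=
  \sum_(k <- finsupp a) \sum_(l <- finsupp b)
     fmono (k + l) (shift_coef k l (a k) (b l)).

Let term_linr k l f : linear (fun g => fmono (k + l) (shift_coef k l f g) : A).
Proof.
move=> c g h; rewrite -fmono_linear; congr fmono; apply: coefP => u.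
by rewrite !(coefD, coefZ, coef_mulE, coef_shiftE); ring.
Qed.

Let term_linl k l g : linear (fun f => fmono (k + l) (shift_coef k l f g) : A).
Proof.
move=> c f h; rewrite -fmono_linear; congr fmono; apply: coefP => u.
by rewrite !(coefD, coefZ, coef_mulE, coef_shiftE); ring.
Qed.

Let inner_linl b k : linear (fun f : coef F =>
  \sum_(l <- finsupp b) fmono (k + l) (shift_coef k l f (b l)) : A).
Proof.
move=> c f g; rewrite scaler_sumr -big_split; apply: eq_bigr => l _ /=.
exact: term_linl.
Qed.

Fact shift_mul_linl b : linear (fun a => shift_mul a b).
Proof. exact: (fsupp_sum_linear (inner_linl b)). Qed.

Fact shift_mul_linr a : linear (shift_mul a).
Proof.
move=> c b b'; rewrite /shift_mul scaler_sumr -big_split.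
apply: eq_bigr => k _ /=.
exact: (fsupp_sum_linear (fun l => term_linr k l (a k))).
Qed.

Lemma shift_mul_mono k l f g :
  shift_mul (fmono k f) (fmono l g) = fmono (k + l) (shift_coef k l f g).
Proof.
rewrite /shift_mul (fsupp_sum_mono (inner_linl (fmono l g))).
exact: (fsupp_sum_mono (fun l => term_linr k l f)).
Qed.

Fact shift_mulA : associative shift_mul.
Proof.
move=> a b c; apply: (linear_fsupp_ext
    (f := fun a => shift_mul a (shift_mul b c))
    (g := fun a => shift_mul (shift_mul a b) c)) => [||k f].
- exact: shift_mul_linl.
- by move=> x u v; rewrite !shift_mul_linl.
apply: (linear_fsupp_ext
    (f := fun b => shift_mul (fmono k f) (shift_mul b c))
    (g := fun b => shift_mul (shift_mul (fmono k f) b) c)) => [||l g].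
- by move=> x u v; rewrite shift_mul_linl shift_mul_linr.
- by move=> x u v; rewrite shift_mul_linr shift_mul_linl.
apply: (linear_fsupp_ext
    (f := fun c => shift_mul (fmono k f) (shift_mul (fmono l g) c))
    (g := shift_mul (shift_mul (fmono k f) (fmono l g)))) => [||m h].
- by move=> x u v; rewrite !shift_mul_linr.
- exact: shift_mul_linr.
rewrite !shift_mul_mono addrA; congr fmono; apply: coefP => u.
rewrite /shift_coef !(coefZ, coef_mulE, coef_shiftE) !intvD !NformDl !NformDr.
by rewrite !qpowD scalerDr addrA; ring.
Qed.

Definition shift_alg : assocAlg R[i] :=
  AssocAlg shift_mul_linl shift_mul_linr shift_mulA.

(** * The modules *)

Section Module.
Variables (M : 'M[int]_D) (delta : 'cV[R]_D).
Hypothesis detM : \det M != 0.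

Local Notation S := (fsupp 'cV[int]_D (R[i]^o)).
Implicit Types x : S.

Definition lattice_pt (k : 'cV[int]_D) : 'cV[R]_D :=
  invmx (map_mx intr M) *m intv R k + delta.

Definition act_val a x (k : 'cV[int]_D) : R[i] :=
  \sum_(n <- finsupp a)
     qpow theta (Nform (lattice_pt k) (intv R n))
     * a n (hbar *: lattice_pt k) * x (k + M *m n).

(* Outside of this finite set of points [act_val] vanishes: see [shift_actE]. *)
Definition act_supp a x : {fset 'cV[int]_D} :=
  [fset k - M *m n | k in finsupp x, n in finsupp a].

Definition shift_act a x : S := [fsfun k in act_supp a x => act_val a x k | 0].

Lemma shift_actE a x k : shift_act a x k = act_val a x k.
Proof.
rewrite /shift_act fsfunE; case: ifPn => // kN.
rewrite /act_val big_seq big1 // => n na.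
have [kx|/fsupp_out ->] := boolP (k + M *m n \in finsupp x);
  last by rewrite mulr0.
case/negP: kN; apply/imfset2P; exists (k + M *m n) => //.
by exists n => //; rewrite addrK.
Qed.

Fact shift_act_linr a : linear (shift_act a).
Proof.
move=> c x y; apply/fsuppP => k; rewrite fsuppD fsuppZ !shift_actE /act_val.
rewrite scaler_sumr -big_split; apply: eq_bigr => n _ /=.
by rewrite fsuppD fsuppZ /GRing.scale /=; ring.
Qed.

Let act_term_lin x k n : linear (fun f : coef F =>
  qpow theta (Nform (lattice_pt k) (intv R n))
     * f (hbar *: lattice_pt k) * x (k + M *m n) : R[i]^o).
Proof. by move=> c f g; rewrite coefD coefZ /GRing.scale /=; ring. Qed.

Fact shift_act_linl x : linear (fun a => shift_act a x).
Proof.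
move=> c a b; apply/fsuppP => k; rewrite fsuppD fsuppZ !shift_actE.
exact: (fsupp_sum_linear (act_term_lin x k)).
Qed.

Lemma shift_act_mono n f x k : shift_act (fmono n f) x k =
  qpow theta (Nform (lattice_pt k) (intv R n))
     * f (hbar *: lattice_pt k) * x (k + M *m n).
Proof. rewrite shift_actE; exact: (fsupp_sum_mono (act_term_lin x k)). Qed.

Lemma lattice_ptD k n : lattice_pt (k + M *m n) = lattice_pt k + intv R n.
Proof.
have unitM : (map_mx intr M : 'M[R]_D) \in unitmx.
  by rewrite unitmxE det_map_mx unitfE intr_eq0.
by rewrite /lattice_pt intvD mulmxDr {2}/intv map_mxM mulKmx // addrAC.
Qed.

Fact shift_actM a b x :
  shift_act (shift_mul a b) x = shift_act a (shift_act b x).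
Proof.
apply: (linear_fsupp_ext (f := fun a => shift_act (shift_mul a b) x)
    (g := fun a => shift_act a (shift_act b x))) => [||m f].
- by move=> c u v; rewrite shift_mul_linl shift_act_linl.
- exact: shift_act_linl.
apply: (linear_fsupp_ext (f := fun b => shift_act (shift_mul (fmono m f) b) x)
    (g := fun b => shift_act (fmono m f) (shift_act b x))) => [||n g].
- by move=> c u v; rewrite shift_mul_linr shift_act_linl.
- by move=> c u v; rewrite shift_act_linl shift_act_linr.
apply/fsuppP=> k; rewrite shift_mul_mono !shift_act_mono lattice_ptD.
move: (lattice_pt k) => p.
rewrite /shift_coef coefZ coef_mulE coef_shiftE !intvD !NformDl !NformDr.
by rewrite !qpowD scalerDr mulmxDr addrA; ring.
Qed.

Definition shift_module : leftModule shift_alg :=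
  @LeftModule _ shift_alg S shift_act shift_act_linl shift_act_linr shift_actM.
End Module.
End ShiftAlgebra.

Definition in_GLZ (R : comUnitRingType) (D : nat) (A : 'M[R]_D) : Prop :=
  exists2 P : 'M[int]_D, P \in unitmx & A = map_mx intr P.

(* Main.v *)
Require Import Defs.
From HB Require Import structures.
From mathcomp Require Import all_boot all_order all_algebra.
From mathcomp Require Import finmap.
From mathcomp Require Import boolp classical_sets functions reals trigo.
From mathcomp Require Import complex.

Set Implicit Arguments.
Unset Strict Implicit.
Unset Printing Implicit Defensive.

Import Order.TTheory GRing.Theory Num.Theory.

Local Open Scope ring_scope.

(** The coefficient functions act diagonally on [S(R, delta)], with joint
    eigenvalue [f |-> f (hbar p)] on the basis vector at [k], where
    [p = R^-1 k + delta]. As F separates points, this joint spectrum is the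
    shifted lattice [R^-1 Z^D + delta], which is thus an isomorphism invariant.
    Conversely, if two modules have the same shifted lattice, matching the basis
    vectors with equal joint eigenvalue is an isomorphism. Two shifted lattices
    agree exactly under the stated arithmetic conditions. *)

(** Allows the inclusion of shifted lattices, derived from an isomorphism in one direction only, to
    be applied both ways. *)
Lemma isomorphic_modules_sym (K : pzRingType) (A : assocAlg K)
    (V W : leftModule A) : isomorphic_modules V W -> isomorphic_modules W V.
Proof.
move=> [phi [[psi phiK psiK] phi_act]].
have psi_lin : linear psi by exact: (can2_linear phiK psiK).
pose psiL := GRing.isLinear.Build K W V *:%R psi psi_lin.
pose psi' : {linear W -> V} := HB.pack psi psiL.
exists psi'; split; first by exists phi.
by move=> a y /=; rewrite -{1}[y]psiK -phi_act phiK.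
Qed.

Section Reindex.
Variables (I : choiceType) (K : pzRingType) (V : lmodType K).
Variables (s t : I -> I).

(** Pullback along [s]. The map [t], a left inverse of [s] in every use, supplies the finite set
    that contains the support. *)
Definition fsupp_reindex (x : fsupp I V) : fsupp I V :=
  [fsfun i in [fset t j | j in finsupp x]%fset => x (s i) | 0].

Hypothesis sK : cancel s t.

Lemma fsupp_reindexE x i : fsupp_reindex x i = x (s i).
Proof.
rewrite /fsupp_reindex fsfunE; case: ifPn => // iN.
have [six|/fsupp_out ->//] := boolP (s i \in finsupp x).
by case/negP: iN; apply/imfsetP; exists (s i); rewrite /= ?sK.
Qed.

Lemma fsupp_reindex_linear : linear fsupp_reindex.
Proof.
move=> c x y; apply/fsuppP => i.
by rewrite fsuppD fsuppZ !fsupp_reindexE fsuppD fsuppZ.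
Qed.
End Reindex.

Lemma qpow0 (R : realType) (theta : R) : qpow theta 0 = 1.
Proof. by rewrite /qpow mulr0 cos0 sin0. Qed.

Lemma intv0 (R : pzRingType) (D : nat) : intv R (0 : 'cV[int]_D) = 0.
Proof. exact: map_mx0. Qed.

Lemma map_intr_mx_inj (R : numDomainType) (m n : nat) :
  injective (map_mx intr : 'M[int]_(m, n) -> 'M[R]_(m, n)).
Proof.
move=> A B AB; apply/matrixP => i j; apply: (@intr_inj R).
by have /matrixP/(_ i j) := AB; rewrite !mxE.
Qed.

Lemma Nform0r (R : realType) (D : nat) (k : 'cV[R]_D) : Nform k 0 = 0.
Proof.
by rewrite /Nform big1 // => m _; rewrite big1 // => n _; rewrite mxE mulr0.
Qed.

Lemma map_intr_unitmx (R : realType) (D : nat) (M : 'M[int]_D) :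
  \det M != 0 -> (map_mx intr M : 'M[R]_D) \in unitmx.
Proof. by move=> detM; rewrite unitmxE det_map_mx unitfE intr_eq0. Qed.

Section Lattices.
Variables (R : realType) (D : nat) (M M' : 'M[int]_D).
Hypotheses (detM : \det M != 0) (detM' : \det M' != 0).
Variables (delta delta' : 'cV[R]_D).

Lemma lattice_pt_inj : injective (lattice_pt M delta).
Proof.
move=> k l /addIr /(can_inj (mulKVmx (map_intr_unitmx R detM))).
exact: map_intr_mx_inj.
Qed.

Lemma lattice_pt0 : lattice_pt M delta 0 = delta.
Proof. by rewrite /lattice_pt intv0 mulmx0 add0r. Qed.

Lemma mulmx_lattice_pt k :
  map_mx intr M *m lattice_pt M delta k = intv R k + map_mx intr M *m delta.
Proof. by rewrite mulmxDr mulKVmx // map_intr_unitmx. Qed.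

Hypothesis sub_lattice :
  forall k, exists l, lattice_pt M delta k = lattice_pt M' delta' l.

(** The point [delta], at index 0 of the first lattice, must be $M'^{-1} l + \delta'$ for some
    integer vector $l$. *)
Lemma sub_lattice_shift :
  map_mx intr M' *m (delta' - delta) \is a mxOver Num.int.
Proof.
have [l] := sub_lattice 0; rewrite lattice_pt0 => ->.
rewrite opprD addrCA subrr addr0 mulmxN mulKVmx ?map_intr_unitmx //.
by apply/mxOverP => i j; rewrite !mxE rpredN intr_int.
Qed.
End Lattices.

(** Subtracting two points removes the offsets, so every $M^{-1} k$ lies in $M'^{-1} \mathbb{Z}^D$
    and $M' M^{-1}$ preserves $\mathbb{Z}^D$. *)
Lemma sub_lattice_mx (R : realType) (D : nat) (M M' : 'M[int]_D)
    (detM' : \det M' != 0) (delta delta' : 'cV[R]_D) :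
  (forall k, exists l, lattice_pt M delta k = lattice_pt M' delta' l) ->
  exists P : 'M[int]_D,
    map_mx intr M' *m invmx (map_mx intr M) = map_mx intr P :> 'M[R]_D.
Proof.
move=> /choice[s sE].
have sB k : map_mx intr M' *m (invmx (map_mx intr M) *m intv R k) =
    intv R (s k - s 0).
  have -> : invmx (map_mx intr M) *m intv R k =
      lattice_pt M delta k - lattice_pt M delta 0.
    by rewrite lattice_pt0 addrK.
  rewrite !sE mulmxBr !mulmx_lattice_pt // opprD addrACA subrr addr0.
  by rewrite /intv map_mxB.
(* Column $j$ is the image of the $j$-th unit vector. *)
exists (\matrix_(i, j) (s (delta_mx j 0) - s 0) i 0).
apply/matrixP => i j; have := sB (delta_mx j 0).
rewrite /intv map_delta_mx mulmxA -colE => /matrixP/(_ i 0).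
by rewrite !mxE.
Qed.

Lemma shift_act_coef (R : realType) (D : nat) (hbar theta : R)
    (F : invSubalg D hbar) (M : 'M[int]_D) (delta : 'cV[R]_D) (f : coef F)
    (x : fsupp 'cV[int]_D R[i]^o) k :
  shift_act theta M delta (fmono 0 f) x k =
  f (hbar *: lattice_pt M delta k) * x k.
Proof. by rewrite shift_act_mono intv0 Nform0r qpow0 mul1r mulmx0 addr0. Qed.

Section Modules.
Variables (R : realType) (D : nat) (hbar theta : R).
Hypothesis hbar_gt0 : 0 < hbar.
Variables (F : invSubalg D hbar) (M M' : 'M[int]_D).
Hypotheses (detM : \det M != 0) (detM' : \det M' != 0).
Variables (delta delta' : 'cV[R]_D).

Local Notation S := (fsupp 'cV[int]_D R[i]^o).

(** The image of the basis vector at [k] is a nonzero joint eigenvector with the same eigenvalues.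
    At an index [l] where it does not vanish, these must be the values at the lattice point of
    [l]. *)
Lemma isomorphic_sub_lattice : separates_points F ->
  isomorphic_modules (shift_module theta F delta detM)
                     (shift_module theta F delta' detM') ->
  forall k, exists l, lattice_pt M delta k = lattice_pt M' delta' l.
Proof.
move=> sepF [phi [/bij_inj phi_inj phi_act]] k.
pose e : S := fmono k (1 : R[i]^o).
pose y : S := phi e.
have [l yl] : exists l, y l != 0.
  apply: contrapT => /forallNP y0.
  have /phi_inj/fsuppP/(_ k) : phi e = phi 0.
    rewrite linear0; apply/fsuppP => l; rewrite fsupp0.
    by apply/eqP/negP => /negP; exact: y0.
  by rewrite fmonoE eqxx fsupp0; apply/eqP/oner_neq0.
exists l; apply: contrapT => neq.
have [|f Ff fneq] := sepF (hbar *: lattice_pt M delta k)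
                          (hbar *: lattice_pt M' delta' l).
  by move/(scalerI (lt0r_neq0 hbar_gt0)).
pose c : coef F := Coef (introT (asboolP _) Ff).
apply: fneq.
(* Off [k] both sides vanish, so [e] is an eigenvector of each $c U^0$. *)
have ce : shift_act theta M delta (fmono 0 c) e =
    c (hbar *: lattice_pt M delta k) *: e.
  apply/fsuppP => m; rewrite shift_act_coef fsuppZ fmonoE.
  by case: eqP => [->//|_]; rewrite mulr0 scaler0.
have /fsuppP/(_ l) := phi_act (fmono 0 c) e.
rewrite /= ce linearZ /= -/y fsuppZ shift_act_coef.
exact: (mulIf yl).
Qed.

(** The phases and coefficients in the action depend on an index only through its lattice point, so
    pullback along [s] respects them. *)
Lemma eq_lattice_isomorphic (s t : 'cV[int]_D -> 'cV[int]_D) :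
  cancel s t -> cancel t s ->
  (forall k, lattice_pt M delta (s k) = lattice_pt M' delta' k) ->
  isomorphic_modules (shift_module theta F delta detM)
                     (shift_module theta F delta' detM').
Proof.
move=> sK tK sE.
(* Both indices name the same lattice point, the one of [s k] translated by [n]. *)
have sD k n : s (k + M' *m n) = s k + M *m n.
  apply: (lattice_pt_inj detM (delta := delta)).
  by rewrite sE !lattice_ptD // sE.
pose phiL := GRing.isLinear.Build _ _ _ _ _
  (fsupp_reindex_linear (V := R[i]^o) sK).
pose phi : {linear S -> S} := HB.pack (fsupp_reindex s t) phiL.
exists phi; split.
  by exists (fsupp_reindex t s) => x; apply/fsuppP => k;
    rewrite /= !fsupp_reindexE // ?sK ?tK.
move=> a x; apply/fsuppP => k.
rewrite /= fsupp_reindexE // !shift_actE /act_val; apply: eq_bigr => n _.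
by rewrite fsupp_reindexE // sD sE.
Qed.
End Modules.

Theorem proposition3p9 (R : realType) (D : nat) (hD : (1 <= D)%N)
    (hbar : R) (hbar_gt0 : 0 < hbar)
    (q : R[i]) (normq : `|q| = 1)
    (theta : R) (q_theta : q = (cos theta +i* sin theta)%C)
    (F : invSubalg D hbar) (sepF : separates_points F)
    (M M' : 'M[int]_D) (detM : \det M != 0) (detM' : \det M' != 0)
    (delta delta' : 'cV[R]_D) :
  isomorphic_modules (shift_module theta F delta detM)
                     (shift_module theta F delta' detM')
  <->
  in_GLZ (map_mx intr M *m invmx (map_mx intr M' : 'M[R]_D))
  /\ map_mx intr M *m (delta - delta') \is a mxOver Num.int.
Proof.
have uM := map_intr_unitmx R detM; have uM' := map_intr_unitmx R detM'.
split=> [iso|[[P uP PE] /mxOverP vint]].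
- have sub := isomorphic_sub_lattice hbar_gt0 sepF iso.
  have iso' := isomorphic_modules_sym iso.
  have sub' := isomorphic_sub_lattice hbar_gt0 sepF iso'.
  split; last exact: (sub_lattice_shift detM sub').
  (* [Q] and [P] are $M' M^{-1}$ and $M M'^{-1}$, mutually inverse over the reals and hence over the
     integers. *)
  have [Q QE] := sub_lattice_mx detM' sub.
  have [P PE] := sub_lattice_mx detM sub'.
  exists P => //; suff /mulmx1_unit[] : P *m Q = 1%:M by [].
  apply: (@map_intr_mx_inj R).
  by rewrite map_mxM map_mx1 -PE -QE mulmxA mulmxKV // mulmxV.
(* The entries are integers by [vint], so taking floors loses nothing. *)
pose v : 'cV[int]_D :=
  \col_i Num.floor ((map_mx intr M *m (delta - delta')) i 0).
have vE : intv R v = map_mx intr M *m (delta - delta').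
  by apply/matrixP => i j; rewrite ord1 mxE [v _ _]mxE floorK.
(* Solving $M^{-1} s(k) + \delta = M'^{-1} k + \delta'$ gives $s(k) = P k - v$. *)
apply: (@eq_lattice_isomorphic _ _ _ _ _ _ _ _ _ _ _
  (fun k => P *m k - v) (fun k => invmx P *m (k + v))).
- by move=> k; rewrite subrK mulKmx.
- by move=> k; rewrite mulKVmx // addrK.
move=> k; apply: (can_inj (mulKmx uM)).
(* After multiplication by $M$, writing $M = P M'$ on the right clears $M'^{-1}$. *)
rewrite mulmx_lattice_pt // -[map_mx intr M in RHS](mulmxKV uM') PE.
rewrite -mulmxA mulmx_lattice_pt // mulmxDr mulmxA -PE mulmxKV //.
rewrite /intv map_mxB map_mxM -PE -/(intv R v) vE mulmxBr opprB addrA.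
by rewrite subrK.
Qed.
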